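(* Let $Z=H-M_x$ on $L^2[0,1]$. Then the point spectrum (set of eigenvalues) of $Z$ is $$\sigma_p(Z)=(-1,0]\cup\mathbb D(1,1).$$
   Context: $H$ is the (bounded) Hardy operator on $L^2[0,1]$ (complex-valued functions), $Hf(x)=\frac1x\int_0^x f(t)\,dt$, and $M_x$ is multiplication by $x$. $\mathbb D(1,1)$ is the open disk in $\mathbb C$ with center $1$ and radius $1$. *)

(* Defs.v *)
From HB Require Import structures.
From mathcomp Require Import all_boot all_order all_algebra.
From mathcomp Require Import all_classical all_reals all_analysis.
From mathcomp Require Import measurable_realfun complex.

Set Implicit Arguments.
Unset Strict Implicit.
Unset Printing Implicit Defensive.

Import Order.TTheory GRing.Theory Num.Theory.
Import numFieldNormedType.Exports.

Local Open Scope classical_set_scope.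
Local Open Scope ring_scope.
Local Open Scope complex_scope.

(* R[i] carries no measurable structure: measurability and integrals of
   complex-valued functions are taken on real and imaginary parts. *)
Section complex_L2.
Context {R : realType}.
Implicit Types (D : set R) (f g : R -> R[i]).

Local Notation mu := (@lebesgue_measure R).
Local Notation I01 := (`[0%R, 1%R]%classic : set R).

Definition cmeasurable_fun D f : Prop :=
  measurable_fun D (fun t => complex.Re (f t)) /\
  measurable_fun D (fun t => complex.Im (f t)).

Definition cintegral D f : R[i] :=
  (\int[mu]_(t in D) complex.Re (f t)) +i* (\int[mu]_(t in D) complex.Im (f t)).

(* An element of L^2[0,1] is represented by a function R -> R[i], whose values
   outside [0,1] are irrelevant; two representatives denote the same element
   when they satisfy [eq_01], which hardy and mulx respect (lemmas
   [hardy_eq_01] and [mulx_eq_01]). *)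
Definition L2_01 f : Prop :=
  cmeasurable_fun I01 f /\
  (\int[mu]_(x in I01) (ComplexField.Normc.normc (f x) ^+ 2)%:E < +oo)%E.

Definition eq_01 f g : Prop := ae_eq mu I01 f g.

Definition hardy f : R -> R[i] := fun x => (x^-1)%:C * cintegral `[0%R, x] f.

Definition mulx f : R -> R[i] := fun x => x%:C * f x.

(* No separate condition that [T f] lie in L^2[0,1] is needed: the last
   conjunct makes it equal, as a class, to z f. *)
Definition point_spectrum (T : (R -> R[i]) -> R -> R[i]) : set R[i] :=
  [set z | exists f,
     [/\ L2_01 f, ~ eq_01 f (fun=> 0) & eq_01 (T f) (fun x => z * f x)]].

Lemma hardy_eq_01 f g : L2_01 f -> L2_01 g -> eq_01 f g ->
  eq_01 (hardy f) (hardy g).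
Proof.
move=> [[mrf mif] _] [[mrg mig] _] fg.
apply/aeW => x /=; rewrite in_itv/= => /andP[x0 x1].
have sub : `[0, x] `<=` I01 by apply: subset_itvl; rewrite bnd_simp.
rewrite /hardy /cintegral; congr (_ * (fine _ +i* fine _)).
- apply: ae_eq_integral => //.
  + by apply/measurable_EFinP; exact: measurable_funS sub mrf.
  + by apply/measurable_EFinP; exact: measurable_funS sub mrg.
  + by apply: filterS fg => y + /sub yI => /(_ yI)/= ->.
- apply: ae_eq_integral => //.
  + by apply/measurable_EFinP; exact: measurable_funS sub mif.
  + by apply/measurable_EFinP; exact: measurable_funS sub mig.
  + by apply: filterS fg => y + /sub yI => /(_ yI)/= ->.
Qed.

Lemma mulx_eq_01 f g : eq_01 f g -> eq_01 (mulx f) (mulx g).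
Proof. by apply: filterS => x + xI => /(_ xI); rewrite /mulx => ->. Qed.

End complex_L2.

(* Main.v *)
Require Import Defs.
From mathcomp Require Import all_boot all_order all_algebra.
From mathcomp Require Import all_classical all_reals all_analysis.
From mathcomp Require Import complex.
From mathcomp Require Import measurable_realfun ring lra.

(* With [F x = \int_0^x f], the eigenvalue equation [H f - x f = z f] reads
   [x (x + z) F' = F], i.e. [F' = q F] with [q = 1 / (x (x + z))].
   Existence: solve explicitly. If [|z - 1| < 1], then
   [F = (x / (x + z)) ^ (1 / z)] and [f] grows like [x ^ (Re (1 / z) - 1)] with
   [Re (1 / z) > 1 / 2]; for [z = 0], [F = exp (- 1 / x)]; for [z = - p] with
   [0 < p < 1], [F = ((x - p) / x) ^ (1 / p)] on [x > p] and [F = 0] on [x <= p].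
   Nonexistence: [G = |F|^2] satisfies [G' = 2 (Re q) G]. When [|z - 1| >= 1], i.e.
   [2 Re z <= |z|^2], one has [2 Re q <= 1 / x + K] near [0], so that [G] positive
   at some point forces [G x >= c x], and then [|f|^2 = |q|^2 G] is at least a
   multiple of [1 / x], which is not integrable. *)

Set Implicit Arguments.
Unset Strict Implicit.
Unset Printing Implicit Defensive.

Import Order.TTheory GRing.Theory Num.Theory.
Import numFieldNormedType.Exports.

Local Open Scope classical_set_scope.
Local Open Scope ring_scope.
Local Open Scope complex_scope.

Section hardy_point_spectrum.
Context {R : realType}.
Local Notation mu := (@lebesgue_measure R).
Local Notation I01 := (`[0%R, 1%R]%classic : set R).
Implicit Types (a b x p : R).

(* Real and imaginary parts of [1 / (x (x + z))] for [z = a + i b]. *)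
Definition res_re a b x : R := (x + a) / (x * ((x + a) ^+ 2 + b ^+ 2)).
Definition res_im a b x : R := - b / (x * ((x + a) ^+ 2 + b ^+ 2)).

(** * Derivatives of primitives, and growth of solutions near [0] *)

Lemma ae_mono (P Q : R -> Prop) : (\forall x \ae mu, P x) ->
  (forall x, P x -> Q x) -> \forall x \ae mu, Q x.
Proof.
move=> aeP PQ; exact: (@filterS _ _ (ae_filter_ringOfSetsType mu) _ _ PQ aeP).
Qed.

Lemma is_derive_inv (x : R) : x != 0 -> is_derive x 1 (fun y : R => y^-1) (- x ^- 2).
Proof.
move=> x0; have h : is_derive x 1 (fun y : R => y^-1) (- x ^- 2 *: 1) by exact: is_deriveV.
by apply: is_derive_eq h _; rewrite /GRing.scale/= mulr1.
Qed.

Lemma primitive_is_derive (g : R -> R) x :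
  mu.-integrable `[0, 1] (EFin \o g) -> 0 < x < 1 -> {for x, continuous g} ->
  is_derive x 1 (fun y => \int[mu]_(t in `[0, y]) g t) (g x).
Proof.
move=> ig /andP[x0 x1] cg; have [d e] := continuous_FTC1_closed x1 ig x0 cg.
apply: DeriveDef; first exact: d.
by rewrite -derive1E; exact: e.
Qed.

(* The three-way disjunction says that [a + i b] lies outside [(-1, 0]]. *)
Lemma res_re_le a b x0 : 0 < x0 < 1 -> 2 * a <= a ^+ 2 + b ^+ 2 ->
  [\/ b != 0, a <= -1 | 0 < a] ->
  exists K, forall x, 0 < x <= x0 -> 2 * res_re a b x <= x^-1 + K.
Proof.
move=> /andP[x0_gt0 x0_lt1] ab nv.
(* [d] bounds [|x + z|^2] from below uniformly on [(0, x0]]. Keeping [x0] below [1] matters for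
   [z = -1], where [x + z] vanishes at [x = 1]. *)
have [d d0 dN] : exists2 d, 0 < d &
    forall x, 0 < x <= x0 -> d <= (x + a) ^+ 2 + b ^+ 2.
  case: nv => [b0|a1|a0].
  - exists (b ^+ 2); first by rewrite exprn_even_gt0.
    by move=> x _; rewrite lerDr sqr_ge0.
  - exists ((1 - x0) ^+ 2); first by rewrite exprn_gt0// subr_gt0.
    by move=> x /andP[? ?]; have := sqr_ge0 b; nra.
  - exists (a ^+ 2); first by rewrite exprn_gt0.
    by move=> x /andP[? ?]; have := sqr_ge0 b; nra.
(* Since [2 a <= |z|^2], one has [2 (x + a) - N <= 2 (1 - a) x] with [N = |x + z|^2]; dividing by
   [x N] and using [N >= d] produces this constant. *)
exists (2 * `|1 - a| / d) => x x0x; have /andP[xp xx0] := x0x.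
have := dN _ x0x; rewrite /res_re; set N := _ + _ => dN'.
have N0 : 0 < N by exact: lt_le_trans dN'.
have -> : 2 * ((x + a) / (x * N)) = 2 * (x + a) / (x * N) by rewrite mulrA.
rewrite ler_pdivrMr ?mulr_gt0//.
have -> : (x^-1 + 2 * `|1 - a| / d) * (x * N) = N + 2 * `|1 - a| * x * (N / d).
  by field; rewrite !gt_eqF.
have : 1 <= N / d by rewrite ler_pdivlMr// mul1r.
have h1 : 1 - a <= `|1 - a| by exact: ler_norm.
have h2 : 0 <= `|1 - a| by [].
move=> Nd; have : `|1 - a| * x <= `|1 - a| * x * (N / d).
  by rewrite ler_peMr// mulr_ge0// ltW.
have : (1 - a) * x <= `|1 - a| * x by rewrite ler_wpM2r// ltW.
rewrite /N; nra.
Qed.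

(** The function [W = G exp (- |K| x) / x] has derivative [(2 Re q - |K| - 1 / x) W <= 0], so
    [W x >= W x0] to the left of [x0]. As the exponential is at most [1], [G x >= W x0 * x]. *)
Lemma gronwall_linear a b (G : R -> R) x0 :
  0 < x0 < 1 -> 2 * a <= a ^+ 2 + b ^+ 2 -> [\/ b != 0, a <= -1 | 0 < a] ->
  (forall x, 0 < x < 1 -> is_derive x 1 G (2 * res_re a b x * G x)) ->
  (forall x, 0 <= G x) -> 0 < G x0 ->
  exists2 c, 0 < c & forall x, 0 < x <= x0 -> c * x <= G x.
Proof.
move=> x01 ab nv dG G0 Gx0; have [K qK] := res_re_le x01 ab nv.
have /andP[x0_gt0 x0_lt1] := x01.
pose W x := G x * expR (- `|K| * x) * x^-1.
have dW x : 0 < x < 1 -> is_derive x 1 W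
    (expR (- `|K| * x) * x^-1 * (2 * res_re a b x - `|K| - x^-1) * G x).
  move=> x01'; have /andP[xp x1] := x01'; have Gd := dG _ x01'.
  have iV := is_derive_inv (lt0r_neq0 xp).
  have iE : is_derive x 1 (fun y => expR (- `|K| * y)) (expR (- `|K| * x) * (- `|K|)).
    have -> : (fun y => expR (- `|K| * y)) = expR \o (- `|K| \*: id) by [].
    by apply: is_derive_eq; rewrite scaler1.
  have -> : W = (G * (fun y => expR (- `|K| * y))) * (fun y => y^-1) by [].
  apply: is_derive_eq; rewrite /GRing.scale/=.
  by rewrite fctE; field; rewrite gt_eqF.
exists (G x0 * expR (- `|K| * x0) * x0^-1).
  by rewrite !mulr_gt0 ?expR_gt0 ?invr_gt0.
move=> x /andP[xp xx0].
have WW : W x0 <= W x.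
  apply: (@ler0_derive1_le_cc _ W x x0) => //.
  - move=> y; rewrite in_itv/= => /andP[xy yx0].
    have y01 : 0 < y < 1 by rewrite (lt_trans xp xy) (lt_trans yx0).
    by have [] := dW y y01.
  - move=> y; rewrite in_itv/= => /andP[xy yx0].
    have y01 : 0 < y < 1 by rewrite (lt_trans xp xy) (lt_trans yx0).
    have [_] := dW y y01; rewrite -derive1E => ->.
    apply: mulr_le0_ge0 => //; apply: mulr_ge0_le0.
      by rewrite mulr_ge0 ?expR_ge0// invr_ge0 ltW// (lt_trans xp xy).
    have := qK y; rewrite (lt_trans xp xy) (ltW yx0) => /(_ isT).
    by have := ler_norm K; lra.
  - apply: derivable_within_continuous => y; rewrite in_itv/= => /andP[xy yx0].
    have y01 : 0 < y < 1 by rewrite (lt_le_trans xp xy) (le_lt_trans yx0).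
    by have [] := dW y y01.
  - by rewrite in_itv/= xx0 lexx.
  - by rewrite in_itv/= xx0 lexx.
apply: (@le_trans _ _ (W x * x)); first by rewrite ler_wpM2r// ltW.
rewrite /W divfK ?gt_eqF// ler_piMr// expR_le1.
by rewrite mulNr oppr_le0 mulr_ge0// ltW.
Qed.

(** * Integrals near the singular endpoint, and almost-everywhere transfer *)

Lemma inv_not_integrable (h : R -> R) (c x0 : R) : 0 < c -> 0 < x0 <= 1 ->
  measurable_fun (`[0, 1] : set R) h -> (forall x, 0 <= x <= 1 -> 0 <= h x) ->
  (\forall x \ae mu, 0 < x <= x0 -> c / x <= h x) ->
  ~ (\int[mu]_(x in `[0%R, 1%R]) (h x)%:E < +oo)%E.
Proof.
move=> c0 /andP[x0_gt0 x0_le1] mh h0 hc foo.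
set I := integral _ _ _ in foo.
have I0 : (0 <= I)%E.
  by apply: integral_ge0 => x /=; rewrite in_itv/= lee_fin; exact: h0.
have If : I = (fine I)%:E by rewrite fineK// ge0_fin_numE.
set M := fine I in If.
have M0 : 0 <= M by rewrite -lee_fin -If.
(* Chosen so that the integral of [c / x] over [[e, x0]], which is [c ln (x0 / e)], equals [M + 1]
   and so exceeds the supposed value [M]. *)
pose e := x0 * expR (- ((M + 1) / c)).
have e0 : 0 < e by rewrite mulr_gt0 ?expR_gt0.
have ex : e < x0.
  rewrite gtr_pMr// expR_lt1 oppr_lt0 divr_gt0//; lra.
have sub : `[e, x0] `<=` `[0, 1].
  by apply: subset_itvScc; rewrite bnd_simp// ltW.
have : (\int[mu]_(x in `[e, x0]) (c / x)%:E <= I)%E.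
  { apply: (@le_trans _ _ (\int[mu]_(x in `[e, x0]) (h x)%:E)%E); last first.
    by apply: ge0_subset_integral => //; exact/measurable_EFinP.
  apply: ae_ge0_le_integral => //.
  - move=> x /=; rewrite in_itv/= => /andP[ex' _].
    by rewrite lee_fin divr_ge0// ltW// (lt_le_trans e0).
  - apply/measurable_EFinP; apply: subspace_continuous_measurable_fun => //.
    apply: derivable_within_continuous => x; rewrite in_itv/= => /andP[ex' _].
    by apply: derivableM => //; apply: derivableV => //; rewrite gt_eqF// (lt_le_trans e0).
  - by move=> x /sub /=; rewrite in_itv/= lee_fin; exact: h0.
  - by apply/measurable_EFinP; exact: measurable_funS sub mh.
  - apply: (ae_mono hc) => x hx.
    rewrite /= in_itv/= => /andP[ex' xx0].
    by rewrite lee_fin hx// (lt_le_trans e0). }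
rewrite (@continuous_FTC2 _ _ (fun x => c * ln x))//.
- rewrite If -EFinB lee_fin /e lnM ?posrE ?expR_gt0// expRK.
  have : c * ((M + 1) / c) = M + 1 by field; rewrite gt_eqF.
  lra.
- apply: derivable_within_continuous => x; rewrite in_itv/= => /andP[ex' _].
  by apply: derivableM => //; apply: derivableV => //; rewrite gt_eqF// (lt_le_trans e0).
- have dl x : e <= x -> is_derive x 1 (fun x => c * ln x) (c / x).
    move=> ex'; have xp := lt_le_trans e0 ex'.
    have il := is_derive1_ln xp.
    have -> : (fun x => c * ln x) = c \*: (@ln R) by [].
    exact: is_derive_eq.
  have cl x : e <= x -> {for x, continuous (fun x => c * ln x)}.
    move=> /dl [d _]; exact/differentiable_continuous/derivable1_diffP.
  split.
  + by move=> x; rewrite in_itv/= => /andP[/ltW/dl[]].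
  + exact/cvg_at_right_filter/cl.
  + exact/cvg_at_left_filter/cl/ltW.
- move=> x; rewrite in_itv/= => /andP[ex' _].
  have xp := lt_trans e0 ex'.
  have il := is_derive1_ln xp.
  rewrite derive1E.
  have -> : (fun x => c * ln x) = c \*: (@ln R) by [].
  by rewrite deriveZ// derive_val.
Qed.

Lemma ge0_integral_oc_le (h : R -> R) (M : R) :
  measurable_fun (`]0, 1] : set R) h -> (forall x, 0 < x <= 1 -> 0 <= h x) ->
  (forall e, 0 < e < 1 -> (\int[mu]_(x in `[e, 1%R]) (h x)%:E <= M%:E)%E) ->
  (\int[mu]_(x in `]0%R, 1%R]) (h x)%:E <= M%:E)%E.
Proof.
move=> mh h0 hM.
(* Monotone convergence along these intervals. Starting at [1 / 2] keeps every left endpoint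
   strictly below [1], as [hM] demands. *)
pose F (n : nat) : set R := `[n.+2%:R^-1, 1]%classic.
have Fsub n : F n `<=` `]0, 1].
  by apply: subset_itvr; rewrite bnd_simp invr_gt0.
have -> : (`]0, 1] : set R)%classic = \bigcup_n F n.
  apply/seteqP; split => [x|x [n _ /Fsub//]].
  rewrite /= in_itv/= => /andP[x0 x1].
  have [n xn] : exists n : nat, x^-1 < n%:R.
    by exists (Num.truncn x^-1).+1; rewrite truncnS_gt.
  exists n => //; rewrite /F/= in_itv/= x1 andbT.
  rewrite invf_ple ?posrE//; apply/ltW/(lt_trans xn).
  by rewrite ltr_nat.
have cF : (\int[mu]_(x in F n) (h x)%:E)%E @[n --> \oo] -->
    (\int[mu]_(x in \bigcup_n F n) (h x)%:E)%E.
  { apply: ge0_nondecreasing_set_cvg_integral.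
  - move=> n m nm; apply/subsetPset/subset_itvr; rewrite bnd_simp.
    by rewrite lef_pV2 ?posrE// ler_nat !ltnS.
  - by move=> n; exact: measurable_itv.
  - by move=> n; apply/measurable_EFinP; exact: measurable_funS (Fsub n) mh.
  - move=> n x /Fsub; rewrite /= in_itv/= lee_fin; exact: h0. }
rewrite -(cvg_lim _ cF)//; apply: lime_le; first by apply/cvg_ex; eexists; exact: cF.
apply: nearW => n; apply: hM; rewrite invr_gt0 ltr0n/=.
by rewrite invf_lt1 ?ltr0n// ltr1n.
Qed.

Lemma ae_neq (c : R) : \forall x \ae mu, x != c.
Proof.
exists [set c]; split; [exact: measurable_set1|exact: lebesgue_measure_set1|].
by move=> x /negP /negPn /eqP ->.
Qed.

Lemma ae_closed_unit_itv (P : R -> Prop) :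
  (\forall x \ae mu, 0 < x < 1 -> P x) -> \forall x \ae mu, 0 <= x <= 1 -> P x.
Proof.
move=> aeP; have aeF := ae_filter_ringOfSetsType mu.
apply: (@filterS3 _ _ aeF _ _ _ _ _ aeP (ae_neq 0) (ae_neq 1)) => x Px x0 x1 /andP[x0' x1'].
by apply: Px; rewrite !lt_neqAle eq_sym x0 x1 x0' x1'.
Qed.

Lemma itv01_cc (x : R) : (`[0, 1]%classic x : Prop) = (0 <= x <= 1).
Proof. by rewrite /= in_itv/=. Qed.

(** Regularity bootstrap: changing [w] on a null set does not change its primitive, so the primitive
    of a merely integrable [w] inherits the derivative that a continuous version provides. *)
Lemma ae_continuous_primitive (w g : R -> R) :
  mu.-integrable `[0, 1] (EFin \o w) ->
  (forall x, 0 < x < 1 -> {for x, continuous g}) ->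
  (\forall x \ae mu, 0 < x < 1 -> w x = g x) ->
  forall x, 0 < x < 1 ->
    is_derive x 1 (fun y => \int[mu]_(t in `[0, y]) w t) (g x).
Proof.
move=> iw cg wg x x01.
(* Nothing is known about [g] outside the open interval; cutting it off there gives a function
   measurable on the whole line. *)
pose h := g \_ `]0, 1[.
have hE y : 0 < y < 1 -> h y = g y.
  by move=> y01; rewrite /h patchE mem_set//= in_itv.
have mh : measurable_fun [set: R] h.
  apply/(measurable_restrictT _ _).1 => //.
  apply: open_continuous_measurable_fun; first exact: interval_open.
  by move=> y; rewrite inE/= in_itv/=; exact: cg.
have mw : measurable_fun I01 w.
  by apply/measurable_EFinP; exact: (measurable_int mu iw).
have wh : \forall y \ae mu, 0 <= y <= 1 -> w y = h y.
  by apply: ae_closed_unit_itv; apply: (ae_mono wg) => y + y01 => ->//; rewrite hE.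
have ih : mu.-integrable `[0, 1] (EFin \o h).
  apply/integrableP; split.
    by apply/measurable_EFinP; exact: measurable_funTS.
  have /integrableP[_] := iw; apply: le_lt_trans.
  { rewrite le_eqVlt; apply/orP; left; apply/eqP/ae_eq_integral => //.
  - by apply: measurableT_comp => //; apply/measurable_EFinP; exact: measurable_funTS.
  - by apply: measurableT_comp => //; exact/measurable_EFinP.
  - by apply: (ae_mono wh) => y + yI; rewrite itv01_cc in yI => /(_ yI) /= ->. }
have ch : {for x, continuous h}.
  apply: (@cvg_trans _ (g @ x)); last by rewrite /= hE//; exact: cg.
  apply: near_eq_cvg; have xoo : x \in `]0, 1[ by rewrite in_itv.
  near=> y; rewrite hE//.
  have : y \in `]0, 1[ by near: y; exact: near_in_itvoo.
  by rewrite in_itv.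
have := primitive_is_derive ih x01 ch; rewrite hE//.
apply: near_eq_is_derive => //.
have xoo : x \in `]0, 1[ by rewrite in_itv.
near=> y; have : y \in `]0, 1[ by near: y; exact: near_in_itvoo.
rewrite in_itv/= => /andP[y0 y1].
have sub : `[0, y] `<=` `[0, 1] by apply: subset_itvl; rewrite bnd_simp ltW.
congr fine; apply: ae_eq_integral => //.
- by apply/measurable_EFinP; exact: measurable_funTS.
- by apply/measurable_EFinP; exact: measurable_funS mw.
- by apply: (ae_mono wh) => t + /sub tI; rewrite itv01_cc in tI => /(_ tI) ->.
Unshelve. all: by end_near. Qed.

(** The expression is [|x + z|^2], which vanishes only at [x = - z], and each of the three cases
    keeps [- z] off [(0, 1)]. *)
Lemma resolvent_denom_gt0 a b x : [\/ b != 0, a <= -1 | 0 < a] -> 0 < x < 1 ->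
  0 < (x + a) ^+ 2 + b ^+ 2.
Proof.
move=> nv /andP[x0 x1]; have := sqr_ge0 b; have := sqr_ge0 (x + a).
case: nv => [b0|a1|a0].
- by have : 0 < b ^+ 2 by [rewrite exprn_even_gt0]; lra.
- by have : 0 < (x + a) ^+ 2 by [rewrite exprn_even_gt0//= ltr0_neq0//; lra]; lra.
- by have : 0 < (x + a) ^+ 2 by [rewrite exprn_even_gt0//= gt_eqF//; lra]; lra.
Qed.

Lemma res_continuous a b x : 0 < x -> 0 < (x + a) ^+ 2 + b ^+ 2 ->
  {for x, continuous (res_re a b)} /\ {for x, continuous (res_im a b)}.
Proof.
move=> x0 N0.
have cD : {for x, continuous (fun y : R => (y * ((y + a) ^+ 2 + b ^+ 2))^-1)}.
  apply: continuousV; first by rewrite gt_eqF// mulr_gt0.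
  apply: continuousM; first exact: cvg_id.
  apply: continuousD; last exact: cvg_cst.
  have cxa : {for x, continuous (fun y : R => y + a)}.
    by apply: continuousD; [exact: cvg_id|exact: cvg_cst].
  exact: (continuousM cxa cxa).
split.
- apply: (continuousM _ cD); apply: continuousD; [exact: cvg_id|exact: cvg_cst].
- apply: (continuousM _ cD); exact: cvg_cst.
Qed.

(** * Nonexistence of eigenfunctions, in real coordinates [f = u + i v] *)

Lemma hardy_real_trivial a b (u v : R -> R) :
  2 * a <= a ^+ 2 + b ^+ 2 -> [\/ b != 0, a <= -1 | 0 < a] ->
  mu.-integrable I01 (EFin \o u) -> mu.-integrable I01 (EFin \o v) ->
  (\int[mu]_(x in I01) (u x ^+ 2 + v x ^+ 2)%:E < +oo)%E ->
  (\forall x \ae mu, 0 < x < 1 ->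
     (x + a) * u x - b * v x = x^-1 * \int[mu]_(t in `[0, x]) u t /\
     (x + a) * v x + b * u x = x^-1 * \int[mu]_(t in `[0, x]) v t) ->
  \forall x \ae mu, 0 <= x <= 1 -> u x = 0 /\ v x = 0.
Proof.
move=> ab nv iu iv uv2 E.
pose U x := \int[mu]_(t in `[0, x]) u t; pose V x := \int[mu]_(t in `[0, x]) v t.
(* [g + i h] is [q (U + i V)]: the eigenvalue equation solved for [f] in terms of its primitive.
   Since [U] and [V] are continuous, so are [g] and [h], and this makes [U] and [V] differentiable
   at every point of [(0, 1)]. *)
pose g x := res_re a b x * U x - res_im a b x * V x.
pose h x := res_re a b x * V x + res_im a b x * U x.
have uvE : \forall x \ae mu, 0 < x < 1 -> u x = g x /\ v x = h x.
  apply: (ae_mono E) => x Ex x01.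
  have [+ +] := Ex x01; rewrite -/(U x) -/(V x) => E1 E2.
  have N0 := resolvent_denom_gt0 nv x01; have /andP[x0 x1] := x01.
  have UE : U x = x * ((x + a) * u x - b * v x) by rewrite E1 mulrA divff ?mul1r// gt_eqF.
  have VE : V x = x * ((x + a) * v x + b * u x) by rewrite E2 mulrA divff ?mul1r// gt_eqF.
  by split; rewrite /g /h UE VE /res_re /res_im; field; rewrite !gt_eqF.
have contU (w : R -> R) : mu.-integrable I01 (EFin \o w) -> forall x, 0 < x < 1 ->
    {for x, continuous (fun y : R => \int[mu]_(t in `[0, y]) w t)}.
  move=> iw x x01.
  have := parameterized_integral_continuous ler01 iw.
  move=> /(continuous_within_itvP _ ltr01)[+ _ _]; apply.
  by rewrite in_itv.
have cont_gh x : 0 < x < 1 -> {for x, continuous g} /\ {for x, continuous h}.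
  move=> x01; have /andP[x0 x1] := x01.
  have [c1 c2] := res_continuous x0 (resolvent_denom_gt0 nv x01).
  have cU := contU u iu x x01; have cV := contU v iv x x01.
  split; first by apply: continuousB; exact: continuousM.
  by apply: continuousD; exact: continuousM.
have dU x : 0 < x < 1 -> is_derive x 1 U (g x).
  apply: ae_continuous_primitive => //; first by move=> y /cont_gh[].
  by apply: (ae_mono uvE) => y + y01 => /(_ y01)[].
have dV x : 0 < x < 1 -> is_derive x 1 V (h x).
  apply: ae_continuous_primitive => //; first by move=> y /cont_gh[].
  by apply: (ae_mono uvE) => y + y01 => /(_ y01)[].
(* In the derivative of [|F|^2] the terms carrying [res_im] cancel. *)
pose G x := U x ^+ 2 + V x ^+ 2.
have G0 x : 0 <= G x by rewrite addr_ge0// sqr_ge0.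
have dG x : 0 < x < 1 -> is_derive x 1 G (2 * res_re a b x * G x).
  move=> x01; have iU := dU x x01; have iV := dV x x01.
  rewrite [G x]/G; have -> : G = U * U + V * V by [].
  apply: is_derive_eq (is_deriveD (is_deriveM iU iU) (is_deriveM iV iV)) _.
  by rewrite /GRing.scale/= /g /h; ring.
have GE x : 0 < x < 1 ->
    g x ^+ 2 + h x ^+ 2 = G x / (x ^+ 2 * ((x + a) ^+ 2 + b ^+ 2)).
  move=> x01; have /andP[x0 x1] := x01.
  have N0 := resolvent_denom_gt0 nv x01.
  by rewrite /G /g /h /res_re /res_im; field; rewrite !gt_eqF.
have Gz x : 0 < x < 1 -> G x = 0.
  move=> x01; apply/eqP; rewrite eq_le G0 andbT leNgt; apply/negP => Gx.
  have [c c0 cG] := gronwall_linear x01 ab nv dG G0 Gx.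
  have /andP[x0 x1] := x01.
  (* [M] bounds [|y + z|^2] on [(0, 1)], whence [|f|^2 = G / (y^2 |y + z|^2) >= c y / (y^2 M) = (c /
     M) / y]. *)
  pose M := (1 + `|a|) ^+ 2 + b ^+ 2.
  have M0 : 0 < M by rewrite ltr_pwDl ?sqr_ge0// exprn_gt0// ltr_pwDl.
  { apply: (@inv_not_integrable (fun y => u y ^+ 2 + v y ^+ 2) (c / M) x _ _ _ _ _ uv2).
  - by rewrite divr_gt0.
  - by rewrite x0 ltW.
  - have mu_ := measurable_int mu iu; have mv_ := measurable_int mu iv.
    by apply: measurable_funD; apply: measurable_funX; exact/measurable_EFinP.
  - by move=> y _; rewrite addr_ge0// sqr_ge0.
  - apply: (ae_mono uvE) => y uvy /andP[y0 yx].
    have y01 : 0 < y < 1 by rewrite y0 (le_lt_trans yx).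
    have [-> ->] := uvy y01; rewrite GE//.
    have N0 := resolvent_denom_gt0 nv y01.
    have NM : (y + a) ^+ 2 + b ^+ 2 <= M.
      rewrite lerD2r -real_normK ?num_real// lerXn2r ?nnegrE// ?addr_ge0//.
      have /andP[_ y1] := y01.
      by rewrite (le_trans (ler_normD _ _))// lerD2r gtr0_norm// ltW.
    rewrite ler_pdivlMr ?mulr_gt0 ?exprn_gt0//.
    apply: le_trans (cG y _); last by rewrite y0.
    have -> : c / M / y * (y ^+ 2 * ((y + a) ^+ 2 + b ^+ 2)) =
       c * y * (((y + a) ^+ 2 + b ^+ 2) / M) by field; rewrite !gt_eqF.
    by rewrite ler_piMr ?mulr_ge0 ?(ltW c0) ?(ltW y0)// ler_pdivrMr// mul1r. }
apply: ae_closed_unit_itv; apply: (ae_mono uvE) => x uvx x01.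
have [-> ->] := uvx x01; have := GE x x01; rewrite Gz// mul0r => /eqP.
by rewrite paddr_eq0 ?sqr_ge0// !sqrf_eq0 => /andP[/eqP -> /eqP ->].
Qed.

(** * Existence: from a phase to a square-integrable eigenfunction *)

Lemma improper_primitive p (w W : R -> R) : 0 <= p ->
  mu.-integrable I01 (EFin \o w) -> (forall x, x <= p -> w x = 0) ->
  (forall x, p < x -> {for x, continuous w}) ->
  (forall x, p < x -> is_derive x 1 W (w x)) ->
  W x @[x --> p^'+] --> 0 ->
  forall x, p < x <= 1 -> \int[mu]_(t in `[0, x]) w t = W x.
Proof.
move=> p0 iw w0 cw dW Wp x /andP[px x1].
pose U y := \int[mu]_(t in `[0, y]) w t.
have Up : U p = 0.
  rewrite /U; under eq_Rintegral.
    move=> t; rewrite inE/= in_itv/= => /andP[_ tp]; rewrite w0//.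
    over.
  by rewrite Rintegral_cst//= mul0r.
have cU : {within `[p, x], continuous U}.
  apply: (@continuous_subspaceW _ _ _ I01).
    by apply: subset_itvScc; rewrite bnd_simp.
  exact: parameterized_integral_continuous ler01 iw.
have /(continuous_within_itvP _ px)[cUoo cUp cUx] := cU.
have cW y : p < y -> {for y, continuous W}.
  by move=> /dW[dWy _]; exact/differentiable_continuous/derivable1_diffP.
(* [W p] may be a meaningless default value ([exp (- 0^-1) = 1] when [F = exp (- 1 / x)]), so it is
   replaced by the limit [0]. Then [D] is continuous on [[p, x]] with zero derivative inside, hence
   constantly [D p = 0]. *)
pose D y := U y - (if y <= p then 0 else W y).
have DE y : p < y -> D y = U y - W y by rewrite /D ltNge => /negbTE ->.
have near_pD y : p < y -> \forall z \near y, U z - W z = D z.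
  by move=> py; near=> z; rewrite DE//; near: z; exact: lt_nbhsr.
have dD y : y \in `]p, x[ -> is_derive y 1 D 0.
  rewrite in_itv/= => /andP[py yx].
  have y01 : 0 < y < 1 by rewrite (le_lt_trans p0 py) (lt_le_trans yx x1).
  have iU := primitive_is_derive iw y01 (cw _ py).
  have iW := dW y py.
  apply: (near_eq_is_derive (near_pD _ py)); have -> : (fun z => U z - W z) = U - W by [].
  by apply: is_derive_eq; rewrite subrr.
have cD : {within `[p, x], continuous D}.
  { apply/(continuous_within_itvP _ px); split.
  - by move=> y /dD[dDy _]; exact/differentiable_continuous/derivable1_diffP.
  - rewrite {2}/D lexx subr0 Up -[X in _ --> X](subrr 0).
    have h : (U y - W y) @[y --> p^'+] --> (0 : R) - 0.
      by apply: cvgB => //; rewrite -Up.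
    apply: cvg_trans h; apply: near_eq_cvg; near=> y; rewrite DE//.
  - rewrite DE//.
    have h : (U y - W y) @[y --> x^'-] --> U x - W x.
      by apply: cvgB => //; apply/cvg_at_left_filter/cW.
    apply: cvg_trans h; apply: near_eq_cvg; near=> y; rewrite DE//. }
have [c _] := MVT_segment (ltW px) dD cD.
by rewrite mul0r DE// {1}/D lexx Up subr0 subr0 => /eqP; rewrite subr_eq0 => /eqP.
Unshelve. all: by end_near. Qed.

(** For [x > 0] the dominating function is [C x^(-m)], whose antiderivative [C x^(1 - m) / (1 - m)]
    is nonnegative and equals [C / (1 - m)] at [1]; this bounds the integrals over [[e, 1]]
    uniformly in [e]. *)
Lemma power_dominated_integral (h : R -> R) (C m : R) : 0 <= C -> m < 1 ->
  measurable_fun I01 h -> (forall x, 0 <= h x) ->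
  (forall x, 0 < x <= 1 -> h x <= C * expR (- m * ln x)) ->
  (\int[mu]_(x in I01) (h x)%:E < +oo)%E.
Proof.
move=> C0 m1 mh h0 hC.
have sub : (`]0, 1] : set R)%classic `<=` I01 by exact: subset_itv_oc_cc.
have mh' : measurable_fun (`]0, 1] : set R) h by exact: measurable_funS sub mh.
rewrite -integral_itv_obnd_cbnd; last exact/measurable_EFinP.
have m1' : 0 < 1 - m by rewrite subr_gt0.
apply: (@le_lt_trans _ _ (C / (1 - m))%:E); last exact: ltry.
apply: ge0_integral_oc_le => // e /andP[e0 e1].
have dpow k x : 0 < x ->
    is_derive x 1 (fun x => expR (k * ln x)) (k * (expR (k * ln x) / x)).
  move=> x0; have il := is_derive1_ln x0.
  have -> : (fun x => expR (k * ln x)) = expR \o (k \*: @ln R) by [].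
  by apply: is_derive_eq; rewrite /GRing.scale/=; ring.
have cf : {within `[e, 1], continuous (fun x => C * expR (- m * ln x))}.
  apply: derivable_within_continuous => x; rewrite in_itv/= => /andP[ex _].
  by have [d _] := dpow (- m) x (lt_le_trans e0 ex); exact: derivableM.
apply: (@le_trans _ _ (\int[mu]_(x in `[e, 1%R]) (C * expR (- m * ln x))%:E)%E).
  { apply: ge0_le_integral => //.
  - by move=> x _; rewrite lee_fin.
  - apply/measurable_EFinP; apply: measurable_funS mh => //.
    by apply: subset_itvr; rewrite bnd_simp ltW.
  - by apply/measurable_EFinP; exact: subspace_continuous_measurable_fun.
  - move=> x /=; rewrite in_itv/= => /andP[ex x1].
    by rewrite lee_fin hC// x1 (lt_le_trans e0). }
pose F x := (C / (1 - m)) * expR ((1 - m) * ln x).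
have dF x : 0 < x -> is_derive x 1 F (C * expR (- m * ln x)).
  move=> x0; have ip := dpow (1 - m) x x0.
  have -> : F = (C / (1 - m)) \*: (fun x => expR ((1 - m) * ln x)) by [].
  apply: is_derive_eq; rewrite /GRing.scale/=.
  have -> : (1 - m) * ln x = ln x + - m * ln x by ring.
  by rewrite expRD lnK ?posrE//; field; rewrite !gt_eqF.
have cF x : 0 < x -> {for x, continuous F}.
  by move=> x0; have [d _] := dF x x0; exact/differentiable_continuous/derivable1_diffP.
rewrite (@continuous_FTC2 _ _ F)//.
- rewrite -EFinB lee_fin /F ln1 mulr0 expR0 mulr1 lerBlDr lerDl.
  by rewrite mulr_ge0 ?expR_ge0// divr_ge0// ltW.
- split.
  + by move=> x; rewrite in_itv/= => /andP[ex _]; have [] := dF x (lt_trans e0 ex).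
  + exact/cvg_at_right_filter/cF.
  + exact/cvg_at_left_filter/cF.
- move=> x; rewrite in_itv/= => /andP[ex _].
  by rewrite derive1E; have [_ ->] := dF x (lt_trans e0 ex).
Qed.

(** Square-integrable implies integrable on a set of finite measure, through
    [|u| <= 1 + u^2 <= 1 + h]. *)
Lemma sq_integrable (u : R -> R) (h : R -> R) :
  measurable_fun I01 u -> measurable_fun I01 h ->
  (forall x, u x ^+ 2 <= h x) -> (\int[mu]_(x in I01) (h x)%:E < +oo)%E ->
  mu.-integrable I01 (EFin \o u).
Proof.
move=> mu_ mh uh hoo.
have h0 x : 0 <= h x by exact: le_trans (sqr_ge0 _) (uh x).
have ih : mu.-integrable I01 (EFin \o h).
  apply/integrableP; split; first exact/measurable_EFinP.
  by under eq_integral do rewrite /= ger0_norm//.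
have i1 : mu.-integrable I01 (EFin \o cst 1).
  apply: continuous_compact_integrable; first exact: segment_compact.
  exact/continuous_subspaceT/cst_continuous.
apply: (le_integrable _ _ _ (integrableD _ i1 ih)) => //.
  exact/measurable_EFinP.
move=> x _ /=; rewrite lee_fin.
rewrite [leRHS]ger0_norm ?addr_ge0//.
have := uh x; rewrite -real_normK ?num_real//.
by have := sqr_ge0 (`|u x| - 1); have := normr_ge0 (u x); nra.
Qed.

(* The eigenfunctions are [F / (x (x + z))] on [x > p] and [0] elsewhere, where
   [F = exp (L + i th)]; the last condition makes them square integrable. *)
Definition eigen_phase a b p (L th : R -> R) (C m : R) : Prop :=
  [/\ forall x, p < x -> 0 < (x + a) ^+ 2 + b ^+ 2,
      forall x, p < x -> is_derive x 1 L (res_re a b x),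
      forall x, p < x -> is_derive x 1 th (res_im a b x),
      expR (L x) @[x --> p^'+] --> 0 &
      forall x, p < x <= 1 ->
        expR (L x) ^+ 2 / (x ^+ 2 * ((x + a) ^+ 2 + b ^+ 2)) <= C * expR (- m * ln x)].

Lemma hardy_real_eigen a b p (L th : R -> R) C m :
  0 <= p < 1 -> 0 <= C -> m < 1 -> eigen_phase a b p L th C m ->
  exists u v : R -> R,
  [/\ measurable_fun I01 u, measurable_fun I01 v,
      (\int[mu]_(x in I01) (u x ^+ 2 + v x ^+ 2)%:E < +oo)%E,
      (forall x, p < x -> 0 < u x ^+ 2 + v x ^+ 2) &
      forall x, 0 <= x <= 1 ->
        (x + a) * u x - b * v x = x^-1 * \int[mu]_(t in `[0, x]) u t /\
        (x + a) * v x + b * u x = x^-1 * \int[mu]_(t in `[0, x]) v t].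
Proof.
move=> /andP[p0 p1] C0 m1 [N0 dL dth Lp bnd].
(* [P + i Q] is [F = exp (L + i th)], and [f + i g] is [q F]; since [L' + i th' = q], this is
   [F']. *)
pose P x := expR (L x) * cos (th x); pose Q x := expR (L x) * sin (th x).
pose f x := res_re a b x * P x - res_im a b x * Q x.
pose g x := res_re a b x * Q x + res_im a b x * P x.
have PQ x : P x ^+ 2 + Q x ^+ 2 = expR (L x) ^+ 2.
  by rewrite /P /Q !exprMn -mulrDr cos2Dsin2 mulr1.
have dP x : p < x -> is_derive x 1 P (f x).
  move=> px; have iL := dL x px; have it := dth x px.
  have -> : P = (expR \o L) * (cos \o th) by [].
  by apply: is_derive_eq; rewrite /GRing.scale/= /f /P /Q; ring.
have dQ x : p < x -> is_derive x 1 Q (g x).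
  move=> px; have iL := dL x px; have it := dth x px.
  have -> : Q = (expR \o L) * (sin \o th) by [].
  by apply: is_derive_eq; rewrite /GRing.scale/= /g /P /Q; ring.
have is_derive_continuous (w : R -> R) (y d : R) : is_derive y 1 w d -> {for y, continuous w}.
  by move=> [dw _]; exact/differentiable_continuous/derivable1_diffP.
have cfg x : p < x -> {for x, continuous f} /\ {for x, continuous g}.
  move=> px; have x0 := le_lt_trans p0 px.
  have [c1 c2] := res_continuous x0 (N0 _ px).
  have cP := is_derive_continuous _ _ _ (dP x px).
  have cQ := is_derive_continuous _ _ _ (dQ x px).
  split; first by apply: continuousB; exact: continuousM.
  by apply: continuousD; exact: continuousM.
pose u := f \_ `]p, +oo[; pose v := g \_ `]p, +oo[.
have uE x : p < x -> u x = f x.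
  by move=> px; rewrite /u patchE mem_set//= in_itv/= px.
have vE x : p < x -> v x = g x.
  by move=> px; rewrite /v patchE mem_set//= in_itv/= px.
have u0 x : x <= p -> u x = 0.
  by move=> px; rewrite /u patchE memNset//= in_itv/= andbT ltNge px.
have v0 x : x <= p -> v x = 0.
  by move=> px; rewrite /v patchE memNset//= in_itv/= andbT ltNge px.
have mpatch (w : R -> R) : (forall x, p < x -> {for x, continuous w}) ->
    measurable_fun I01 (w \_ `]p, +oo[).
  move=> cw; apply: measurable_funTS; apply/(measurable_restrictT _ _).1 => //.
  apply: open_continuous_measurable_fun; first exact: interval_open.
  by move=> y; rewrite inE/= in_itv/= andbT; exact: cw.
have mu_ : measurable_fun I01 u by apply: mpatch => x /cfg[].
have mv_ : measurable_fun I01 v by apply: mpatch => x /cfg[].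
have muv : measurable_fun I01 (fun x => u x ^+ 2 + v x ^+ 2).
  by apply: measurable_funD; exact: measurable_funX.
have uv2E x : p < x -> u x ^+ 2 + v x ^+ 2 =
    expR (L x) ^+ 2 / (x ^+ 2 * ((x + a) ^+ 2 + b ^+ 2)).
  move=> px; have x0 := le_lt_trans p0 px; have N0x := N0 x px.
  rewrite uE// vE// -PQ /f /g /res_re /res_im; field.
  by rewrite !gt_eqF.
have uvoo : (\int[mu]_(x in I01) (u x ^+ 2 + v x ^+ 2)%:E < +oo)%E.
  apply: (power_dominated_integral C0 m1 muv).
    by move=> x; rewrite addr_ge0// sqr_ge0.
  move=> x /andP[x0 x1]; have [xp|px] := leP x p.
    by rewrite u0// v0// expr0n/= addr0 mulr_ge0// expR_ge0.
  by rewrite uv2E// bnd// px.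
have iu : mu.-integrable I01 (EFin \o u).
  by apply: (sq_integrable mu_ muv _ uvoo) => x; rewrite lerDl sqr_ge0.
have iv : mu.-integrable I01 (EFin \o v).
  by apply: (sq_integrable mv_ muv _ uvoo) => x; rewrite lerDr sqr_ge0.
have cpatch (w : R -> R) x : p < x -> {for x, continuous w} ->
    {for x, continuous (w \_ `]p, +oo[)}.
  move=> px cw; have E y : p < y -> (w \_ `]p, +oo[) y = w y.
    by move=> py; rewrite patchE mem_set//= in_itv/= py.
  apply: (@cvg_trans _ (w @ x)); last by rewrite /= E.
  by apply: near_eq_cvg; near=> y; rewrite E//; near: y; exact: lt_nbhsr.
have expR_dom (w : R -> R) : (forall x, `|w x| <= 1) ->
    expR (L x) * w x @[x --> p^'+] --> 0.
  move=> w1; apply/norm_cvg0P/(squeeze_cvgr _ (cvg_cst 0) Lp).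
  near=> x; rewrite normr_ge0/= normrM gtr0_norm ?expR_gt0//.
  by rewrite ler_piMr// expR_ge0.
have intU x : p < x <= 1 -> \int[mu]_(t in `[0, x]) u t = P x.
  { apply: improper_primitive => // [y py|y py|].
  - by apply: cpatch => //; have [] := cfg y py.
  - by rewrite uE//; exact: dP.
  - by apply: expR_dom => x'; exact: cos_max. }
have intV x : p < x <= 1 -> \int[mu]_(t in `[0, x]) v t = Q x.
  { apply: improper_primitive => // [y py|y py|].
  - by apply: cpatch => //; have [] := cfg y py.
  - by rewrite vE//; exact: dQ.
  - by apply: expR_dom => x'; exact: sin_max. }
exists u, v; split => // [x px|x /andP[x0 x1]].
  have x0 := le_lt_trans p0 px; have N0x := N0 x px.
  by rewrite uv2E// divr_gt0 ?mulr_gt0 ?exprn_gt0 ?expR_gt0.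
(* Up to [p] the functions and their primitives all vanish, so both equations read [0 = 0]; this
   covers [x = 0], where [x^-1] is a default value. *)
have [xp|px] := leP x p.
  have int0 (w : R -> R) : (forall y, y <= p -> w y = 0) ->
      \int[mu]_(t in `[0, x]) w t = 0.
    move=> w0; under eq_Rintegral.
      move=> t; rewrite inE/= in_itv/= => /andP[_ tx]; rewrite w0 ?(le_trans tx)//.
      over.
    by rewrite Rintegral_cst//= mul0r.
  by rewrite u0// v0// !int0// !mulr0 subr0 addr0.
have x0' := le_lt_trans p0 px; have N0x := N0 x px.
rewrite intU ?px// intV ?px// uE// vE// /f /g /res_re /res_im.
by split; field; rewrite !gt_eqF.
Unshelve. all: by end_near. Qed.

(** * The three explicit families of solutions *)

Lemma eigen_phase_zero : eigen_phase 0 0 0 (fun x => - x^-1) (cst 0) 16 0.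
Proof.
(* Squaring [y <= exp y] at [y = 1 / (2 x)]. It gives [|f|^2 = exp (- 2 / x) / x^4 <= 16], the
   source of the constant. *)
have le4 x : 0 < x -> expR (- x^-1) <= 4 * x ^+ 2.
  move=> x0; rewrite expRN invf_ple ?posrE ?expR_gt0 ?mulr_gt0 ?exprn_gt0//.
  have -> : x^-1 = (2 * x)^-1 + (2 * x)^-1 by field; rewrite gt_eqF.
  have h : (2 * x)^-1 <= expR (2 * x)^-1.
    by apply: le_trans (expR_ge1Dx _); rewrite lerDr.
  have -> : (4 * x ^+ 2)^-1 = (2 * x)^-1 * (2 * x)^-1 by field; rewrite gt_eqF.
  by rewrite expRD ler_pM// invr_ge0 mulr_ge0// ltW.
split.
- by move=> x x0; rewrite addr0 expr0n/= addr0 exprn_gt0.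
- move=> x x0; have iV := is_derive_inv (lt0r_neq0 x0).
  by apply: is_derive_eq; rewrite /res_re; field; rewrite gt_eqF.
- by move=> x x0; rewrite /res_im oppr0 mul0r; exact: is_derive_cst.
- have hlim : 4 * x @[x --> (0 : R)^'+] --> 0.
    apply/cvg_at_right_filter; rewrite -[X in _ --> X](mulr0 4).
    by apply: cvgM; [exact: cvg_cst|exact: cvg_id].
  apply: (squeeze_cvgr _ (cvg_cst 0) hlim); near=> x; have x0 : 0 < x by [].
  have x1 : x < 1 by near: x; exact: nbhs_right_lt.
  rewrite /= expR_ge0/=; apply: le_trans (le4 _ x0) _.
  by rewrite ler_pM2l// expr2 ger_pMr// ltW.
- move=> x /andP[x0 x1]; rewrite oppr0 mul0r expR0 mulr1 !addr0 expr0n/= addr0.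
  rewrite ler_pdivrMr ?mulr_gt0 ?exprn_gt0//.
  have -> : 16 * (x ^+ 2 * x ^+ 2) = (4 * x ^+ 2) ^+ 2 by ring.
  by rewrite lerXn2r ?nnegrE ?expR_ge0 ?le4// mulr_ge0// sqr_ge0.
Unshelve. all: by end_near. Qed.

(** The phase comes from the partial fractions [1 / (x (x - p)) = (1 / (x - p) - 1 / x) / p]. *)
Lemma eigen_phase_neg p : 0 < p < 1 ->
  eigen_phase (- p) 0 p (fun x => p^-1 * (ln (x - p) - ln x)) (cst 0) (p ^- 4) 0.
Proof.
move=> /andP[p0 p1].
(* The base [(x - p) / x] is below [1] and the exponent [1 / p] is at least [1]. The resulting
   factor [(x - p)^2] in [|F|^2] cancels the singularity at [p] and leaves
   [|f|^2 <= x^(-4) <= p^(-4)]. *)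
have le1 x : p < x -> expR (p^-1 * (ln (x - p) - ln x)) <= (x - p) / x.
  move=> px; have x0 := lt_trans p0 px.
  rewrite -ln_div ?posrE ?subr_gt0//.
  have q0 : 0 < (x - p) / x by rewrite divr_gt0// subr_gt0.
  rewrite -[leRHS]lnK ?posrE// ler_expR -[leRHS]mul1r ler_wnM2r//.
    by apply: ln_le0; rewrite ler_pdivrMr// mul1r gerBl ltW.
  by rewrite invf_ge1// ltW.
split.
- by move=> x px; rewrite expr0n/= addr0 exprn_gt0// subr_gt0.
- move=> x px; have x0 := lt_trans p0 px; have xp0 : 0 < x - p by rewrite subr_gt0.
  have i1 := is_derive1_ln xp0; have i2 := is_derive1_ln x0.
  have i3 : is_derive x 1 (fun y => ln (y - p)) (x - p)^-1.
    have -> : (fun y => ln (y - p)) = (@ln R) \o (id - cst p) by [].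
    by apply: is_derive_eq; rewrite subr0 mulr1.
  have -> : (fun y => p^-1 * (ln (y - p) - ln y)) =
    p^-1 \*: ((fun y => ln (y - p)) - @ln R) by [].
  apply: is_derive_eq; rewrite /GRing.scale/= /res_re; field.
  by rewrite !gt_eqF// expr0n/= addr0 mulr_gt0.
- by move=> x x0; rewrite /res_im oppr0 mul0r; exact: is_derive_cst.
- have hlim : p^-1 * (x - p) @[x --> p^'+] --> 0.
    apply/cvg_at_right_filter; rewrite -[X in _ --> X](mulr0 p^-1) -(subrr p).
    by apply: cvgM; [exact: cvg_cst|apply: cvgB; [exact: cvg_id|exact: cvg_cst]].
  apply: (squeeze_cvgr _ (cvg_cst 0) hlim); near=> x; have px : p < x by [].
  rewrite /= expR_ge0/=; apply: le_trans (le1 _ px) _.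
  rewrite mulrC ler_pM2r ?subr_gt0//.
  by rewrite lef_pV2 ?posrE ?(lt_trans p0 px)// ltW.
- move=> x /andP[px x1]; rewrite oppr0 mul0r expR0 mulr1 expr0n/= addr0.
  have x0 := lt_trans p0 px; have xp0 : 0 < x - p by rewrite subr_gt0.
  rewrite ler_pdivrMr ?mulr_gt0 ?exprn_gt0//.
  apply: (@le_trans _ _ (((x - p) / x) ^+ 2)).
    by rewrite lerXn2r ?nnegrE ?expR_ge0 ?le1// divr_ge0// ltW.
  have -> : ((x - p) / x) ^+ 2 = x ^- 4 * (x ^+ 2 * (x - p) ^+ 2) by field; rewrite gt_eqF.
  rewrite ler_pM2r ?mulr_gt0 ?exprn_gt0//.
  by rewrite lef_pV2 ?posrE ?exprn_gt0// lerXn2r ?nnegrE// ltW.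
Unshelve. all: by end_near. Qed.

(** Here [1 / z = s - i t] and, as [x + a > 0], [atan (b / (x + a))] is the argument of [x + z]; [L]
    and [th] are the real and imaginary parts of [(1 / z) (ln x - ln (x + z))]. *)
Lemma eigen_phase_disk a b (n := a ^+ 2 + b ^+ 2) (s := a / n) (t := b / n)
  (N := fun x => (x + a) ^+ 2 + b ^+ 2)
  (L := fun x => s * ln x - s / 2 * ln (N x) - t * atan (b / (x + a)))
  (th := fun x => - t * ln x + t / 2 * ln (N x) - s * atan (b / (x + a)))
  (B := expR (- (s / 2 * ln n) + `|t| * (pi / 2))) :
  n < 2 * a -> eigen_phase a b 0 L th (B ^+ 2 / n) (2 - 2 * s).
Proof.
move=> na.
have a0 : 0 < a by have := sqr_ge0 a; have := sqr_ge0 b; rewrite /n in na; lra.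
have n0 : 0 < n by rewrite ltr_pwDl ?sqr_ge0// exprn_gt0.
have s0 : 0 < s by rewrite divr_gt0.
have nN x : 0 < x -> n <= N x.
  by move=> x0; rewrite lerD2r lerXn2r ?nnegrE ?ltW ?addr_gt0// ltrDr.
have N0 x : 0 < x -> 0 < N x by move=> /nN; exact: lt_le_trans.
have dlnN x : 0 < x -> is_derive x 1 (fun y => ln (N y)) (2 * (x + a) / N x).
  move=> x0; have i1 := is_derive1_ln (N0 x x0).
  have i2 : is_derive x 1 N (2 * (x + a)).
    have -> : N = (id + cst a) * (id + cst a) + cst (b ^+ 2) by [].
    by apply: is_derive_eq; rewrite /GRing.scale/= !fctE; ring.
  have -> : (fun y => ln (N y)) = (@ln R) \o N by [].
  by apply: is_derive_eq; rewrite mulrC.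
have datan x : 0 < x -> is_derive x 1 (fun y => atan (b / (y + a))) (- b / N x).
  move=> x0; have xa : 0 < x + a by rewrite addr_gt0.
  have i1 : is_derive x 1 (fun y => (y + a)^-1) (- (x + a) ^- 2).
    have i0 := is_derive_inv (lt0r_neq0 xa).
    have -> : (fun y => (y + a)^-1) = (fun y : R => y^-1) \o (id + cst a) by [].
    by apply: is_derive_eq; rewrite addr0 mulr1.
  have i2 : is_derive x 1 (fun y => b / (y + a)) (b * - (x + a) ^- 2).
    have -> : (fun y => b / (y + a)) = b \*: (fun y => (y + a)^-1) by [].
    exact: is_derive_eq.
  have -> : (fun y => atan (b / (y + a))) = (@atan R) \o (fun y => b / (y + a)) by [].
  apply: is_derive_eq; rewrite /GRing.scale/= /N; field.
  by rewrite !gt_eqF// ?N0//= ltr_pwDl ?sqr_ge0// exprn_gt0.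
(* From [N x >= n] and [|atan| <= pi / 2]. Thus [|F| <= B x^s], and
   [|f|^2 <= (B^2 / n) x^(2 s - 2)]. *)
have leB x : 0 < x -> expR (L x) <= B * expR (s * ln x).
  move=> x0; rewrite -expRD ler_expR /L.
  have h1 : s / 2 * ln n <= s / 2 * ln (N x).
    by rewrite ler_pM2l ?divr_gt0// ler_ln ?posrE ?N0 ?nN.
  have h2 : - (t * atan (b / (x + a))) <= `|t| * (pi / 2).
    apply: le_trans (ler_norm _) _; rewrite normrN normrM ler_wpM2l// ler_norml.
    by rewrite !ltW ?atan_ltpi2 ?atan_gtNpi2.
  by lra.
have B0 : 0 < B by exact: expR_gt0.
split; first exact: N0.
- move=> x x0; have i1 := dlnN x x0; have i2 := datan x x0; have i3 := is_derive1_ln x0.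
  have -> : L = s \*: (@ln R) - (s / 2) \*: (fun y => ln (N y)) -
    t \*: (fun y => atan (b / (y + a))) by [].
  apply: is_derive_eq; rewrite /GRing.scale/= /res_re -/(N x) /s /t.
  have N0' := N0 x x0; rewrite /n /N in N0' n0 *; field.
  by rewrite !gt_eqF.
- move=> x x0; have i1 := dlnN x x0; have i2 := datan x x0; have i3 := is_derive1_ln x0.
  have -> : th = (- t) \*: (@ln R) + (t / 2) \*: (fun y => ln (N y)) -
    s \*: (fun y => atan (b / (y + a))) by [].
  apply: is_derive_eq; rewrite /GRing.scale/= /res_im -/(N x) /s /t.
  have N0' := N0 x x0; rewrite /n /N in N0' n0 *; field.
  by rewrite !gt_eqF.
- have hlim : B * x `^ s @[x --> 0^'+] --> 0.
    rewrite -[X in _ --> X](mulr0 B).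
    by apply: cvgM; [exact: cvg_cst|exact: powR_cvg0].
  apply: (squeeze_cvgr _ (cvg_cst 0) hlim); near=> x; have x0 : 0 < x by [].
  rewrite /= expR_ge0/=; apply: le_trans (leB _ x0) _.
  by rewrite /powR gt_eqF.
- move=> x /andP[x0 x1].
  have -> : expR (- (2 - 2 * s) * ln x) = expR (s * ln x) * expR (s * ln x) / x / x.
    have -> : - (2 - 2 * s) * ln x = s * ln x + s * ln x - ln x - ln x by ring.
    by rewrite !expRD expRN lnK ?posrE.
  have -> : B ^+ 2 / n * (expR (s * ln x) * expR (s * ln x) / x / x) =
    (B * expR (s * ln x)) ^+ 2 * (x ^+ 2 * n)^-1 by field; rewrite !gt_eqF.
  apply: ler_pM => //.
  + by rewrite invr_ge0 mulr_ge0 ?sqr_ge0// ltW// N0.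
  + by rewrite lerXn2r ?nnegrE ?mulr_ge0 ?expR_ge0 ?leB// ltW.
  + by rewrite lef_pV2 ?posrE ?mulr_gt0 ?exprn_gt0 ?N0// ler_pM2l ?exprn_gt0// nN.
Unshelve. all: by end_near. Qed.

(** * Passage between complex functions and pairs of real functions *)

Lemma hardy_eigen_eqE (f : R -> R[i]) (z : R[i]) x :
  (hardy f \- mulx f) x = z * f x <->
  (x + complex.Re z) * complex.Re (f x) - complex.Im z * complex.Im (f x) =
    x^-1 * \int[mu]_(t in `[0, x]) complex.Re (f t) /\
  (x + complex.Re z) * complex.Im (f x) + complex.Im z * complex.Re (f x) =
    x^-1 * \int[mu]_(t in `[0, x]) complex.Im (f t).
Proof.
rewrite /= /hardy /mulx /cintegral.
set U := Rintegral _ _ _; set V := Rintegral _ _ _.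
case: (f x) z => u v [a b] /=; split.
  case; rewrite !mul0r !subr0 !addr0 => e1 e2.
  by split; lra.
case=> e1 e2; apply/eqP; rewrite eq_complex /=; apply/andP.
by split; apply/eqP; lra.
Qed.

Lemma sqr_normc (z : R[i]) :
  ComplexField.Normc.normc z ^+ 2 = complex.Re z ^+ 2 + complex.Im z ^+ 2.
Proof. by case: z => a b /=; rewrite sqr_sqrtr// addr_ge0// sqr_ge0. Qed.

(** Expanding [|z - 1|^2 < 1], the constants cancel. The condition amounts to [Re (1 / z) > 1 / 2],
    the threshold for square integrability at [0]. *)
Lemma mem_unit_diskE (a b : R) :
  (`|(a +i* b : R[i]) - 1| < 1) = (a ^+ 2 + b ^+ 2 < 2 * a).
Proof.
rewrite normc_def ltcE /= eqxx oppr0 addr0 /=.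
rewrite -[X in _ < X]sqrtr1 ltr_sqrt ?ltr01//.
by apply/idP/idP; lra.
Qed.

Lemma hardy_eigen_nonexistence (f : R -> R[i]) (a b : R) :
  2 * a <= a ^+ 2 + b ^+ 2 -> [\/ b != 0, a <= -1 | 0 < a] ->
  L2_01 f -> eq_01 (hardy f \- mulx f) (fun x => (a +i* b) * f x) ->
  eq_01 f (fun=> 0).
Proof.
move=> ab nv [[mre mim] L2] E.
have L2' : (\int[mu]_(x in I01)
    (complex.Re (f x) ^+ 2 + complex.Im (f x) ^+ 2)%:E < +oo)%E.
  by under eq_integral do rewrite -sqr_normc.
have mh : measurable_fun I01 (fun x => complex.Re (f x) ^+ 2 + complex.Im (f x) ^+ 2).
  by apply: measurable_funD; exact: measurable_funX.
have ire : mu.-integrable I01 (EFin \o (fun x => complex.Re (f x))).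
  by apply: (sq_integrable mre mh _ L2') => x; rewrite lerDl sqr_ge0.
have iim : mu.-integrable I01 (EFin \o (fun x => complex.Im (f x))).
  by apply: (sq_integrable mim mh _ L2') => x; rewrite lerDr sqr_ge0.
have H := hardy_real_trivial ab nv ire iim L2'.
have {}H : \forall x \ae mu, 0 <= x <= 1 -> complex.Re (f x) = 0 /\ complex.Im (f x) = 0.
  apply: H; apply: (ae_mono E) => x Ex /andP[x0 x1].
  by apply/(hardy_eigen_eqE f (a +i* b)); apply: Ex; rewrite /= in_itv/= !ltW.
apply: (ae_mono H) => x fx0.
rewrite itv01_cc => /fx0; case: (f x) => u v /= [-> ->]; exact: erefl.
Qed.

Lemma hardy_eigen_existence a b p (L th : R -> R) (C m : R) :
  0 <= p < 1 -> 0 <= C -> m < 1 -> eigen_phase a b p L th C m ->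
  point_spectrum (fun f : R -> R[i] => hardy f \- mulx f) (a +i* b).
Proof.
move=> p01 C0 m1 ph.
have [u [v [mu_ mv_ uvoo uvp E]]] := hardy_real_eigen p01 C0 m1 ph.
have /andP[p0 p1] := p01.
exists (fun x => u x +i* v x); split.
- split; first by split.
  by under eq_integral do rewrite sqr_normc.
(* The function is nonzero throughout [(p, 1)], an interval of positive measure [1 - p]. *)
- move=> f0.
  have neg : mu.-negligible (`]p, 1[ : set R)%classic.
    apply: negligibleS f0 => x /=; rewrite in_itv/= => /andP[px x1] h.
    have := h; rewrite in_itv/= (le_trans p0 (ltW px)) (ltW x1) => /(_ isT)[ux vx].
    by have := uvp x px; rewrite ux vx expr0n/= addr0 ltxx.
  have := (negligibleP mu (measurable_itv _)).1 neg.
  rewrite /= lebesgue_measure_itv/= lte_fin p1.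
  by rewrite -EFinB => -[] /eqP; rewrite subr_eq0 gt_eqF.
- apply: aeW => x; rewrite itv01_cc => /E Ex.
  exact/hardy_eigen_eqE.
Qed.
End hardy_point_spectrum.

Theorem theorem1p9 (R : realType) :
  point_spectrum (fun f : R -> R[i] => hardy f \- mulx f) =
  [set r%:C | r in `]-1, 0] ] `|` [set z : R[i] | `|z - 1| < 1].
Proof.
apply/seteqP; split => [[a b] [f [L2f f0 fz]]|z].
- have [ab|ab] := ltP (a ^+ 2 + b ^+ 2) (2 * a); first by right; rewrite /= mem_unit_diskE.
  left; apply: contrapT => nseg; apply: f0.
  apply: hardy_eigen_nonexistence ab _ L2f fz.
  have [b0|b0] := eqVneq b 0; last exact: Or31.
  have [a1|a1] := leP a (-1); first exact: Or32.
  have [a0|a0] := leP a 0; last exact: Or33.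
  by case: nseg; exists a; rewrite /= ?in_itv/= ?a1 ?a0// b0.
- case=> [[r + <-]|]; last first.
    case: z => a b /=; rewrite mem_unit_diskE => ab.
    have n0 : 0 < a ^+ 2 + b ^+ 2.
      have a0 : 0 < a by have := sqr_ge0 a; have := sqr_ge0 b; lra.
      by rewrite ltr_pwDl ?sqr_ge0// exprn_gt0.
    apply: (@hardy_eigen_existence _ _ _ _ _ _ _ _ _ _ _ (eigen_phase_disk ab)).
    + by rewrite lexx ltr01.
    + by rewrite divr_ge0 ?sqr_ge0// ltW.
    (* The exponent [m = 2 - 2 s] is below [1] exactly because [s = Re (1 / z) > 1 / 2]. *)
    + have : 1 < 2 * (a / (a ^+ 2 + b ^+ 2)) by rewrite mulrA ltr_pdivlMr// mul1r.
      lra.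
  rewrite /= in_itv/= -complexr0 => /andP[r1 r0].
  move: r0; rewrite le_eqVlt => /predU1P[->|r0].
    apply: (hardy_eigen_existence _ _ _ eigen_phase_zero) => //.
    by rewrite lexx ltr01.
  have p01 : 0 < - r < 1 by rewrite oppr_gt0 r0 ltrNl.
  have /andP[p0 p1] := p01; have := eigen_phase_neg p01; rewrite !opprK => H.
  apply: (hardy_eigen_existence _ _ _ H) => //.
  + by rewrite ltW.
  + by rewrite invr_ge0 exprn_ge0// ltW.
Qed.
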